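(* Let $X$ be a complex Banach space and let $A,B,C\in L(X)$ be such that $A(BA)^2=ABACA=ACABA=(AC)^2A$. Then $\sigma_d(AC)=\sigma_d(BA)$.
   Context: $L(X)$ denotes the Banach algebra (with identity $I$) of all bounded linear operators from $X$ to itself. For a ring $R$ with identity $1$ and $a\in R$, $comm(a)=\{x\in R : xa=ax\}$ and $comm^2(a)=\{x\in R : xy=yx \text{ for all } y\in comm(a)\}$. $R^{qnil}$ is the set of quasinilpotent elements of $R$, i.e. those $a\in R$ such that $1+xa$ is a unit of $R$ for every $x\in comm(a)$. An element $a\in R$ has a g-Drazin inverse if there exists $b\in R$ such that $b=bab$, $b\in comm^2(a)$ and $a-a^2b\in R^{qnil}$. $R^{d}$ is the set of all elements of $R$ that have a g-Drazin inverse. For $T\in L(X)$, the g-Drazin spectrum is $\sigma_d(T)=\{\lambda\in\mathbb{C} : \lambda I-T\notin L(X)^{d}\}$. *)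

(* Defs.v *)
From HB Require Import structures.
From mathcomp Require Import all_boot all_order all_algebra.
From mathcomp Require Import complex.
From mathcomp Require Import all_classical all_reals.
From mathcomp Require Import topology normedtype.
Set Implicit Arguments.
Unset Strict Implicit.
Unset Printing Implicit Defensive.
Import Order.TTheory GRing.Theory Num.Theory.
Import numFieldNormedType.Exports.
Local Open Scope classical_set_scope.
Local Open Scope ring_scope.

(* Rings may be trivial ([pzRingType]): L(X) is the zero ring when X = 0.
   MathComp only has units for types with a computable inverse, so
   invertibility is restated as the existence of a two-sided inverse. *)
Section GeneralizedDrazin.
Variable R : pzRingType.
Implicit Types a b : R.

Definition invertible a : Prop := exists b, a * b = 1 /\ b * a = 1.

Definition commutant a : set R := [set x | GRing.comm x a].

Definition bicommutant a : set R :=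
  [set x | forall y, commutant a y -> GRing.comm x y].

Definition quasinilpotent : set R :=
  [set a | forall x, commutant a x -> invertible (1 + x * a)].

Definition is_gDrazin_inverse a b : Prop :=
  [/\ b = b * a * b, bicommutant a b & quasinilpotent (a - a ^+ 2 * b)].

Definition gDrazin_invertible : set R :=
  [set a | exists b, is_gDrazin_inverse a b].

End GeneralizedDrazin.

Section BoundedOperators.
Variables (K : numFieldType) (X : normedModType K).

Definition bounded_operator (f : X -> X) : Prop :=
  linear f /\ exists M : K, forall x, `|f x| <= M * `|x|.

Definition bounded_operator_pred : {pred X -> X} :=
  fun f => `[< bounded_operator f >].

Record bounded_end := BoundedEnd {
  bounded_end_fun :> X -> X;
  bounded_endP : bounded_end_fun \in bounded_operator_pred }.

HB.instance Definition _ := [isSub for bounded_end_fun].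
HB.instance Definition _ := [Choice of bounded_end by <:].

Lemma bounded_operator_ge0 f : bounded_operator f ->
  exists2 M : K, 0 <= M & forall x, `|f x| <= M * `|x|.
Proof.
move=> [_ [M fM]]; have [M0|M0] := boolP (0 <= M); first by exists M.
exists 0 => // x; rewrite mul0r; have [->|x0] := eqVneq x 0.
  by have := fM 0; rewrite normr0 mulr0.
have x_gt0 : 0 < `|x| by rewrite normr_gt0.
by move: M0; rewrite -(pmulr_lge0 M x_gt0) (le_trans _ (fM x)).
Qed.

Lemma bounded_operator_continuous (f : {linear X -> X}) :
  bounded_operator f <-> continuous f.
Proof.
rewrite -linear_bounded_continuous; split=> [|fb].
  move=> /bounded_operator_ge0[M M0 fM]; apply/linear_boundedP.
  near=> r => x; rewrite (le_trans (fM x))// ler_wpM2r//.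
  by near: r; apply: nbhs_pinfty_ge; rewrite ger0_real.
split; first exact: linearP.
have /pinfty_ex_gt0[M _ fM] := (linear_boundedP f).1 fb; by exists M.
Unshelve. all: by end_near. Qed.

Lemma bounded_operator_submod : submod_closed bounded_operator_pred.
Proof.
split.
  apply/asboolP; split=> [k x y|]; first by rewrite /= scaler0 addr0.
  by exists 0 => x; rewrite mul0r /= normr0.
move=> k f g /asboolP Hf /asboolP Hg; apply/asboolP.
have [M M0 fM] := bounded_operator_ge0 Hf.
have [N N0 gN] := bounded_operator_ge0 Hg.
case: Hf Hg => [fl _] [gl _]; split.
  move=> c x y; change (k *: f (c *: x + y) + g (c *: x + y) =
    c *: (k *: f x + g x) + (k *: f y + g y)).
  rewrite fl gl !scalerDr !scalerA mulrC -!addrA; congr (_ + _).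
  by rewrite addrCA.
exists (`|k| * M + N) => x; change (`|k *: f x + g x| <= (`|k| * M + N) * `|x|).
rewrite mulrDl (le_trans (ler_normD _ _))// lerD// normrZ -mulrA.
by rewrite ler_wpM2l.
Qed.

HB.instance Definition _ :=
  GRing.isSubmodClosed.Build K (X -> X) bounded_operator_pred
    bounded_operator_submod.
HB.instance Definition _ :=
  [SubChoice_isSubLmodule of bounded_end by <:].

Lemma bounded_operator_id : idfun \in bounded_operator_pred.
Proof. by apply/asboolP; split=> //; exists 1 => x; rewrite mul1r. Qed.

Lemma bounded_operator_comp (f g : bounded_end) :
  f \o g \in bounded_operator_pred.
Proof.
have /asboolP Hf := bounded_endP f; have /asboolP Hg := bounded_endP g.
have [M M0 fM] := bounded_operator_ge0 Hf.
case: Hf Hg => [fl _] [gl [N gN]]; apply/asboolP; split.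
  by move=> k x y; rewrite /= gl fl.
exists (M * N) => x; rewrite (le_trans (fM _))// -mulrA.
exact: ler_wpM2l.
Qed.

Definition bounded_end1 := BoundedEnd bounded_operator_id.
Definition bounded_end_mul (f g : bounded_end) :=
  BoundedEnd (bounded_operator_comp f g).

Lemma bounded_end_ext (f g : bounded_end) : (forall x, f x = g x) -> f = g.
Proof. by move=> fg; apply/val_inj/funext. Qed.

Lemma bounded_end_linear (f : bounded_end) : linear f.
Proof. by have /asboolP[] := bounded_endP f. Qed.

Lemma bounded_end_mulA : associative bounded_end_mul.
Proof. by move=> f g h; apply: bounded_end_ext. Qed.

Lemma bounded_end_mul1r : left_id bounded_end1 bounded_end_mul.
Proof. by move=> f; apply: bounded_end_ext. Qed.

Lemma bounded_end_mulr1 : right_id bounded_end1 bounded_end_mul.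
Proof. by move=> f; apply: bounded_end_ext. Qed.

Lemma bounded_end_mulDl : left_distributive bounded_end_mul +%R.
Proof. by move=> f g h; apply: bounded_end_ext. Qed.

Lemma bounded_end_mulDr : right_distributive bounded_end_mul +%R.
Proof.
move=> f g h; apply: bounded_end_ext => x.
by have := bounded_end_linear f 1 (g x) (h x); rewrite !scale1r.
Qed.

HB.instance Definition _ := GRing.Zmodule_isPzRing.Build bounded_end
  bounded_end_mulA bounded_end_mul1r bounded_end_mulr1
  bounded_end_mulDl bounded_end_mulDr.

(* The algebra structures of MathComp require a nontrivial ring, so the
   compatibility of scaling and composition is only stated as lemmas. *)
Lemma bounded_end_scaleAl (k : K) (f g : bounded_end) :
  k *: (f * g) = (k *: f) * g.
Proof. exact: bounded_end_ext. Qed.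

Lemma bounded_end_scaleAr (k : K) (f g : bounded_end) :
  k *: (f * g) = f * (k *: g).
Proof.
apply: bounded_end_ext => x; apply/esym.
have f0 : f 0 = 0.
  by have := bounded_end_linear f (-1) 0 0; rewrite !scaler0 addr0 scaleN1r addNr.
by have := bounded_end_linear f k (g x) 0; rewrite f0 !addr0.
Qed.

Lemma bounded_endD (f g : bounded_end) x : (f + g) x = f x + g x.
Proof. by []. Qed.
Lemma bounded_endN (f : bounded_end) x : (- f) x = - f x.
Proof. by []. Qed.
Lemma bounded_endM (f g : bounded_end) x : (f * g) x = f (g x).
Proof. by []. Qed.
Lemma bounded_endE1 x : (1 : bounded_end) x = x.
Proof. by []. Qed.
Lemma bounded_endZ k (f : bounded_end) x : (k *: f) x = k *: f x.
Proof. by []. Qed.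

Definition gDrazin_spectrum (T : bounded_end) : set K :=
  [set l | ~ gDrazin_invertible (l *: (1 : bounded_end) - T)].

End BoundedOperators.

(* Main.v *)
Require Import Defs.
From mathcomp Require Import all_boot all_order all_algebra.
From mathcomp Require Import complex.
From mathcomp Require Import all_classical all_reals.
From mathcomp Require Import topology normedtype.
Import GRing.Theory.
Local Open Scope ring_scope.

(** Everything happens in an arbitrary ring, for elements a, b, c for which the
four words a x a y a, with x and y among b and c, agree.  Write beta = b a and
alpha = a c.  The point is to carry the g-Drazin inverse of beta, or of
1 - beta, over to alpha, or to 1 - alpha; the spectral statement follows by
scaling a.

When b = c this is the classical passage between b a and a b (Cline's formula
and Jacobson's lemma), where x |-> a x b and y |-> b y a exchange the two sides.
In general the words agree only after an a on each side, so these maps need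
some padding.  If y commutes with alpha, then b y alpha^2 a commutes with beta
([commutant_lift]); dually, if r is in the double commutant of beta, then
a r beta^3 c is in that of alpha ([bicommutant_transfer]).  Moreover
1 + x alpha is a factor of 1 - (x alpha)^4, and Jacobson's lemma relates the
latter to 1 - z beta, where z is the lift of x^4; so quasinilpotency passes from
beta to alpha ([quasinilpotent_transfer]).

The padding is free on the range of a spectral idempotent.  Let t in the double
commutant of beta satisfy t beta t = t.  Then t = t^4 beta^3, so t absorbs any
padding: t c a = t b a, and q = a t c is an idempotent in the double commutant
of alpha.

- If t is the g-Drazin inverse of beta, then a t^2 c is that of alpha.  Its
  residue is a (1 - beta t) c, and beta (1 - beta t) is quasinilpotent.  As
  a (1 - beta t), b, c again satisfy the hypothesis on words, the transfer of
  quasinilpotency applies to them.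

- If d is the g-Drazin inverse of 1 - beta, let p = 1 - (1 - beta) d.  Since
  (1 - beta) p is quasinilpotent, beta is invertible on the range of p; let t be
  this partial inverse.  Then 1 - alpha has the g-Drazin inverse
  (1 - q) (1 + alpha + alpha^2 + alpha^3) + a beta^3 d c, which is the geometric
  series with its tail alpha^4 (1 - alpha)^-1 replaced by a beta^3 d c.

Both arguments go from b a to a c.  The converse is obtained by applying the
same implication three times, along a c, c a, a b, b a
([balanced_words_transfer_iff]). *)

(** * Invertibility *)

Lemma invertible_of_commuting_factor {R : pzRingType} (x y : R) :
  GRing.comm x y -> invertible (x * y) -> invertible x.
Proof.
move=> xy [i [xyi ixy]].
have right_inv : x * (y * i) = 1 by rewrite mulrA.
have left_inv : i * y * x = 1 by rewrite -mulrA -xy.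
exists (y * i); split=> //.
by rewrite -[y * i]mul1r -{1}left_inv -(mulrA (i * y)) right_inv mulr1.
Qed.

Lemma invertible_sub_expr {R : pzRingType} (x : R) (n : nat) :
  invertible (1 - x ^+ n) -> invertible (1 - x).
Proof.
rewrite -opprB subrX1 -mulNr opprB; apply: invertible_of_commuting_factor.
by apply: commr_sum => i _; apply: commrX; apply/commr_sym/commrB => //;
  exact: commr1.
Qed.

(** Jacobson's lemma: formally, (1 - y x)^-1 = 1 + y (1 - x y)^-1 x. *)
Lemma invertible_1subM_swap {R : pzRingType} (x y : R) :
  invertible (1 - x * y) -> invertible (1 - y * x).
Proof.
move=> [i [ri li]]; exists (1 + y * i * x).
have ri' : x * y * i = i - 1.
  by apply/eqP; rewrite eq_sym subr_eq addrC -subr_eq; rewrite -ri mulrBl mul1r.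
have li' : i * x * y = i - 1.
  by apply/eqP; rewrite eq_sym subr_eq addrC -subr_eq; rewrite -li mulrBr mulr1 mulrA.
split.
  rewrite mulrBl mul1r mulrDr mulr1 !mulrA.
  have -> : y * x * y * i * x = y * (x * y * i) * x by rewrite !mulrA.
  by rewrite ri' mulrBr mulrBl mulr1 subrKC addrK.
rewrite mulrBr mulr1 mulrDl mul1r !mulrA.
have -> : y * i * x * y * x = y * (i * x * y) * x by rewrite !mulrA.
by rewrite li' mulrBr mulrBl mulr1 subrKC addrK.
Qed.

(** * Commutants and double commutants *)

Lemma bicommutant_id {R : pzRingType} (a : R) : bicommutant a a.
Proof. by move=> y /commr_sym. Qed.

Lemma bicommutant_comm {R : pzRingType} (a x y : R) :
  bicommutant a x -> bicommutant a y -> GRing.comm x y.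
Proof. by move=> bx by_; apply/bx/by_. Qed.

Lemma bicommutant1 {R : pzRingType} (a : R) : bicommutant a 1.
Proof. by move=> y _; apply/commr_sym/commr1. Qed.

Lemma bicommutantD {R : pzRingType} (a x y : R) :
  bicommutant a x -> bicommutant a y -> bicommutant a (x + y).
Proof.
by move=> bx by_ z az; apply/commr_sym/commrD; apply/commr_sym; [apply: bx|apply: by_].
Qed.

Lemma bicommutantB {R : pzRingType} (a x y : R) :
  bicommutant a x -> bicommutant a y -> bicommutant a (x - y).
Proof.
by move=> bx by_ z az; apply/commr_sym/commrB; apply/commr_sym; [apply: bx|apply: by_].
Qed.

Lemma bicommutantM {R : pzRingType} (a x y : R) :
  bicommutant a x -> bicommutant a y -> bicommutant a (x * y).
Proof.
by move=> bx by_ z az; apply/commr_sym/commrM; apply/commr_sym; [apply: bx|apply: by_].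
Qed.

Lemma bicommutantX {R : pzRingType} (a x : R) (n : nat) :
  bicommutant a x -> bicommutant a (x ^+ n).
Proof. by move=> bx z az; apply/commr_sym/commrX/commr_sym/bx. Qed.

Lemma bicommutant_inverse {R : pzRingType} (a x y : R) :
  x * y = 1 -> y * x = 1 -> bicommutant a x -> bicommutant a y.
Proof.
move=> xy yx bx z az; rewrite /GRing.comm.
by rewrite -[y * z]mulr1 -xy -mulrA (mulrA z) -(bx z az) !mulrA yx mul1r.
Qed.

Lemma commutant_1sub {R : pzRingType} (a y : R) :
  commutant (1 - a) y <-> commutant a y.
Proof.
have sub1 b : commutant b y -> commutant (1 - b) y.
  by move=> ?; apply: commrB => //; exact: commr1.
by split=> [/sub1|/sub1//]; rewrite subKr.
Qed.

Lemma bicommutant_1sub {R : pzRingType} (a x : R) :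
  bicommutant (1 - a) x <-> bicommutant a x.
Proof. by split=> bx y /commutant_1sub; apply: bx. Qed.

(** * Multiplication by a central unit *)

Lemma gDrazin_invertibleM_central {R : pzRingType} (k k' a : R) :
  k * k' = 1 -> (forall x, GRing.comm k x) ->
  gDrazin_invertible a -> gDrazin_invertible (k * a).
Proof.
move=> kk' kC [b [bab ba res]].
have k'k : k' * k = 1 by rewrite -kC.
have k'C x : GRing.comm k' x.
  by apply: (bicommutant_inverse 1 k k' kk' k'k _ x (commr1 x)) => y _.
have comm_ka d y : commutant (k * d) y -> commutant d y.
  move=> ka; rewrite /commutant /=.
  have -> : d = k' * (k * d) by rewrite mulrA k'k mul1r.
  by apply: commrM => //; apply/commr_sym/k'C.
have kab : k * a * (k' * b) = a * b.
  by rewrite -mulrA (mulrA a) -(k'C a) -mulrA mulrA kk' mul1r.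
exists (k' * b); split.
- by rewrite -[RHS]mulrA kab -mulrA (mulrA b) -bab.
- by move=> y /comm_ka/ba yb; apply/commr_sym/commrM; apply/commr_sym.
- have -> : k * a - (k * a) ^+ 2 * (k' * b) = k * (a - a ^+ 2 * b).
    by rewrite mulrBr !expr2 -(mulrA (k * a)) kab !mulrA.
  move=> x xk; rewrite mulrA; apply: res; apply/commr_sym/commrM.
    exact/commr_sym/(comm_ka _ _ xk).
  exact/commr_sym/kC.
Qed.

(** * Transfer of commutation and quasinilpotency *)

(** The hypothesis of the theorem, normalised so that every word rewrites to
the one in a and b alone. *)
Definition balanced_words {R : pzRingType} (a b c : R) :=
  [/\ a * b * a * c * a = a * b * a * b * a,
      a * c * a * b * a = a * b * a * b * a &
      a * c * a * c * a = a * b * a * b * a].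

Section Transfer.
Variables (R : pzRingType) (a b c : R).
Hypothesis bal : balanced_words a b c.

(** The case b = c would allow b y a; the factor alpha^2 supplies enough letters
for the words to agree. *)
Definition lift_commutant (y : R) : R := b * y * (a * c) ^+ 2 * a.

Let wbc x : x * a * b * a * c * a = x * a * b * a * b * a.
Proof. by case: bal => e _ _; rewrite -!(mulrA x) e. Qed.
Let wcb x : x * a * c * a * b * a = x * a * b * a * b * a.
Proof. by case: bal => _ e _; rewrite -!(mulrA x) e. Qed.
Let wcc x : x * a * c * a * c * a = x * a * b * a * b * a.
Proof. by case: bal => _ _ e; rewrite -!(mulrA x) e. Qed.

Lemma ab_ac2 : a * b * (a * c) ^+ 2 = (a * c) ^+ 3.
Proof. by case: bal => e1 e2 e3; rewrite !exprS expr0 mulr1 !mulrA e1 e3. Qed.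

Lemma ac2_aba : (a * c) ^+ 2 * a * (b * a) = (a * c) ^+ 3 * a.
Proof. by rewrite !exprS expr0 !mulr1 !mulrA wcb wcc. Qed.

Lemma ac3_a : (a * c) ^+ 3 * a = a * (b * a) ^+ 3.
Proof.
by case: bal => e1 e2 e3; rewrite !exprS expr0 !mulr1 !mulrA e3 wbc.
Qed.

Lemma b_ac3 : b * (a * c) ^+ 3 = (b * a) ^+ 3 * c.
Proof. by rewrite !exprS expr0 !mulr1 !mulrA wcc. Qed.

Lemma lift_mul_ba y :
  lift_commutant y * (b * a) = b * (y * (a * c) ^+ 3 * a).
Proof.
have -> : lift_commutant y * (b * a) = b * y * ((a * c) ^+ 2 * a * (b * a)).
  by rewrite /lift_commutant; move: (_ ^+ 2) => s2; rewrite !mulrA.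
by rewrite ac2_aba; move: (_ ^+ 3) => s3; rewrite !mulrA.
Qed.

Lemma mul_lift y :
  commutant (a * c) y -> a * lift_commutant y = y * (a * (b * a) ^+ 3).
Proof.
move=> ya; have yac n : GRing.comm y ((a * c) ^+ n) by apply: commrX.
rewrite -ac3_a /lift_commutant; move: ab_ac2 (yac 2) (yac 3).
move: (_ ^+ 2) (_ ^+ 3) => s2 s3 abs2 ys2 ys3.
by rewrite -(mulrA b) ys2 !mulrA abs2 -ys3.
Qed.

Lemma lift_mul y :
  commutant (a * c) y -> lift_commutant y * c = (b * a) ^+ 3 * c * y.
Proof.
move=> ya; have yac n : GRing.comm y ((a * c) ^+ n) by apply: commrX.
rewrite -b_ac3 -[RHS]mulrA -yac (exprSr (a * c) 2) /lift_commutant.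
by move: (_ ^+ 2) => s2; rewrite !mulrA.
Qed.

(** Multiplying the lift by beta on either side gives b y alpha^3 a, because y can
be moved across the powers of alpha. *)
Lemma commutant_lift y :
  commutant (a * c) y -> commutant (b * a) (lift_commutant y).
Proof.
move=> ya; rewrite /commutant /= /GRing.comm lift_mul_ba -(mulrA b a) mul_lift//.
by rewrite -ac3_a !mulrA.
Qed.

(** With z the lift of y, the identities a z = y a beta^3 and z c = beta^3 c y let
y cross a r beta^3 c from right to left: it becomes z next to c, passes r by
hypothesis, and turns back into y on the left of a. *)
Lemma bicommutant_transfer r :
  bicommutant (b * a) r -> bicommutant (a * c) (a * r * (b * a) ^+ 3 * c).
Proof.
move=> br y ya; rewrite /GRing.comm.
have rb3 : GRing.comm r ((b * a) ^+ 3) by apply/commrX/br.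
have -> : a * r * (b * a) ^+ 3 * c * y = a * r * lift_commutant y * c.
  by rewrite -[RHS]mulrA lift_mul//; move: (_ ^+ 3) => b3; rewrite !mulrA.
rewrite -(mulrA a) (br _ (commutant_lift _ ya)) mulrA mul_lift//.
by rewrite -(mulrA a r) rb3; move: (_ ^+ 3) => b3; rewrite !mulrA.
Qed.

(** The lift z of x^4 satisfies z beta = b alpha^3 x^4 a, and Jacobson's lemma
moves a to the front, where a b alpha^3 x^4 = (x alpha)^4.  Finally 1 + x alpha
divides 1 - (x alpha)^4. *)
Lemma quasinilpotent_transfer : quasinilpotent (b * a) -> quasinilpotent (a * c).
Proof.
move=> qba x xac.
have yac : commutant (a * c) (x ^+ 4) by apply/commr_sym/commrX/commr_sym.
have zba := commutant_lift _ yac.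
have /qba : commutant (b * a) (- lift_commutant (x ^+ 4)).
  exact/commr_sym/commrN/commr_sym.
have xacX n : GRing.comm (x ^+ 4) ((a * c) ^+ n) by apply: commrX.
rewrite mulNr lift_mul_ba xacX mulrA (mulrA b) => /invertible_1subM_swap.
have -> : a * (b * (a * c) ^+ 3 * x ^+ 4) = (x * (a * c)) ^+ 4.
  rewrite (exprMn_comm 4 xac) xacX mulrA; congr (_ * _).
  by rewrite (exprSr _ 2) 2!mulrA ab_ac2 -exprSr.
(* The even exponent absorbs the sign. *)
have -> : 1 + x * (a * c) = 1 - - (x * (a * c)) by rewrite opprK.
by move=> inv; apply: (invertible_sub_expr _ 4); rewrite exprNn -signr_odd mul1r.
Qed.

Lemma aca_ba : a * c * a * (b * a) = a * (b * a) * (b * a).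
Proof. by case: bal => _ e _; rewrite !mulrA. Qed.

(** * Outer inverses in the double commutant *)

Section OuterInverse.
Variable t : R.
Hypotheses (bt : bicommutant (b * a) t) (tt : t * (b * a) * t = t).

Lemma outer_comm : t * (b * a) = b * a * t.
Proof. exact: bt. Qed.

(** This is how t absorbs padding by powers of beta. *)
Lemma outer_expand n : t = t ^+ n.+1 * (b * a) ^+ n.
Proof.
elim: n => [|n IH]; first by rewrite mulr1.
rewrite (exprS t n.+1) (exprSr (b * a)) mulrA -(mulrA t) -IH.
by rewrite -(mulrA t t) outer_comm mulrA tt.
Qed.

Lemma outer_ca : t * (c * a) = t * (b * a).
Proof.
rewrite {1 2}(outer_expand 2).
have e : (b * a) ^+ 2 * (c * a) = (b * a) ^+ 2 * (b * a).
  by rewrite expr2 !mulrA wbc.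
by rewrite -!(mulrA (t ^+ 3)) e.
Qed.

Lemma aca_outer : a * c * a * t = a * (b * a) * t.
Proof.
have e : t = b * a * (t * t) by rewrite mulrA -outer_comm tt.
by rewrite {1}e mulrA aca_ba -(mulrA (a * _)) -e.
Qed.

(** On the range of the idempotent a t c, alpha acts as beta does on that of
t beta. *)
Lemma outer_mul_acX r n :
  a * (r * t) * c * (a * c) ^+ n = a * (r * t * (b * a) ^+ n) * c.
Proof.
elim: n => [|n IH]; first by rewrite !mulr1.
rewrite exprSr mulrA IH exprSr.
have batn : GRing.comm t ((b * a) ^+ n) by apply/commrX/bt.
have -> : r * t * (b * a) ^+ n = r * (b * a) ^+ n * t.
  by rewrite -(mulrA r) batn mulrA.
have -> : r * t * ((b * a) ^+ n * (b * a)) = r * (b * a) ^+ n * (t * (b * a)).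
  by rewrite mulrA -(mulrA r) batn !mulrA.
by rewrite -outer_ca !mulrA.
Qed.

Lemma bicommutant_outer r :
  bicommutant (b * a) r -> bicommutant (a * c) (a * (r * t) * c).
Proof.
move=> br.
have -> : a * (r * t) * c = a * (r * t ^+ 4) * (b * a) ^+ 3 * c.
  by rewrite {1}(outer_expand 3) (mulrA r) (mulrA a).
by apply: bicommutant_transfer; apply: bicommutantM => //; apply: bicommutantX.
Qed.

Lemma outer_idem : (a * t * c) * (a * t * c) = a * t * c.
Proof.
have -> : a * t * c * (a * t * c) = a * (t * (c * a)) * t * c by rewrite !mulrA.
by rewrite outer_ca -(mulrA a) tt.
Qed.

End OuterInverse.

End Transfer.
Arguments outer_ca {R a b c} bal {t}.
Arguments aca_outer {R a b c} bal {t}.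
Arguments outer_idem {R a b c} bal {t}.
Arguments outer_mul_acX {R a b c} bal {t}.
Arguments bicommutant_outer {R a b c} bal {t}.
Arguments quasinilpotent_transfer {R a b c} bal.

(** * The g-Drazin inverse of a c *)

(** Compressing to the complement e of a spectral idempotent of b a keeps the
words balanced: each inner e is absorbed by the next one to its right. *)
Lemma balanced_words_absorb_right {R : pzRingType} (a b c e : R) :
  e * b * a * e = b * a * e -> e * c * a * e = c * a * e ->
  balanced_words a b c -> balanced_words (a * e) b c.
Proof.
move=> eb ec [e1 e2 e3].
have word x y : e * x * a * e = x * a * e -> e * y * a * e = y * a * e ->
    a * e * x * (a * e) * y * (a * e) = a * x * a * y * a * e.
  move=> ex ey.
  have -> : a * e * x * (a * e) * y * (a * e) = a * (e * x * a * e) * y * a * e.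
    by rewrite !mulrA.
  rewrite ex.
  have -> : a * (x * a * e) * y * a * e = a * x * a * (e * y * a * e).
    by rewrite !mulrA.
  by rewrite ey !mulrA.
by split; rewrite !word// (e1, e2, e3).
Qed.

(** Cline's formula for balanced words; the inverse of a c is a t^2 c. *)
Lemma gDrazin_invertible_transfer {R : pzRingType} (a b c : R) :
  balanced_words a b c ->
  gDrazin_invertible (b * a) -> gDrazin_invertible (a * c).
Proof.
move=> bal [t [tt' bt res]].
have tt : t * (b * a) * t = t by [].
have tC : t * (b * a) = b * a * t by apply: bt.
have tca := outer_ca bal bt tt.
(* alpha times its inverse is the idempotent a t c. *)
have act : a * c * (a * (t * t) * c) = a * t * c.
  have -> : a * c * (a * (t * t) * c) = (a * c * a * t) * t * c.
    by rewrite !mulrA.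
  by rewrite (aca_outer bal bt tt) -(mulrA a) -tC -(mulrA a) tt.
exists (a * (t * t) * c); split.
- rewrite -[RHS]mulrA act.
  have -> : a * (t * t) * c * (a * t * c) = a * (t * (t * (c * a)) * t) * c.
    by rewrite !mulrA.
  by rewrite tca -(mulrA t) tt.
- exact: (bicommutant_outer bal bt tt t bt).
set e := 1 - b * a * t.
have pe x : t * (x * a) = t * (b * a) -> e * x * a * e = x * a * e.
  move=> tx.
  have -> : e * x * a * e = x * a * e - b * a * t * (x * a) * e.
    by rewrite -(mulrA e) {1}/e mulrBl mul1r mulrBl.
  have be : b * a * e = e * (b * a).
    by rewrite /e mulrBr mulrBl mulr1 mul1r -(mulrA _ t) tC.
  have pe0 : b * a * t * e = 0.
    by rewrite /e mulrBr mulr1 -(mulrA (b * a) t) (mulrA t) tt subrr.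
  have -> : b * a * t * (x * a) * e = b * a * t * e * (b * a).
    by rewrite -(mulrA _ t) tx -[RHS]mulrA -be !mulrA.
  by rewrite pe0 mul0r subr0.
have -> : a * c - (a * c) ^+ 2 * (a * (t * t) * c) = a * e * c.
  rewrite expr2 -(mulrA (a * c)) act.
  have -> : a * c * (a * t * c) = a * c * a * t * c by rewrite !mulrA.
  by rewrite (aca_outer bal bt tt) /e mulrBr mulr1 mulrBl !mulrA.
apply: (@quasinilpotent_transfer _ (a * e) b c).
  by apply: balanced_words_absorb_right => //; apply: pe.
rewrite mulrA; suff -> : b * a * e = b * a - (b * a) ^+ 2 * t by [].
by rewrite /e mulrBr mulr1 expr2 !mulrA.
Qed.

(** * The g-Drazin inverse of 1 - a c *)

Lemma aca_ba_pow {R : pzRingType} (a b c : R) n : balanced_words a b c ->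
  a * c * (a * (b * a) ^+ n.+1) = a * (b * a) ^+ n.+2.
Proof.
move=> bal; rewrite (exprS _ n.+1) (exprS _ n); move: (_ ^+ n) => z.
have -> : a * c * (a * (b * a * z)) = a * c * a * (b * a) * z by rewrite !mulrA.
by rewrite (aca_ba _ _ _ _ bal) !mulrA.
Qed.

(** The case b = c of the transfer, where the words are trivially balanced. *)
Lemma quasinilpotent_swap {R : pzRingType} (x y : R) :
  quasinilpotent (x * y) -> quasinilpotent (y * x).
Proof. by apply: quasinilpotent_transfer. Qed.

(** p is the spectral idempotent of x at 1.  Quasinilpotency of (1 - x) p makes
1 - (1 - x) p invertible; it agrees with x on the range of p, so its inverse m
gives the partial inverse t = p m of x there. *)
Lemma spectral_outer_inverse {R : pzRingType} (x d : R) :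
  is_gDrazin_inverse (1 - x) d ->
  exists p t, [/\ bicommutant x t, t * x = p, p * t = t &
    [/\ (1 - x) * d = 1 - p, p * d = 0 & quasinilpotent ((1 - x) * p)]].
Proof.
move=> [dsd /bicommutant_1sub bd]; move sE : (1 - x) dsd => s dsd res.
have bs : bicommutant x s.
  by rewrite -sE; apply/bicommutant_1sub; exact: bicommutant_id.
have sd : s * d = d * s by apply: (bicommutant_comm _ _ _ bs bd).
have [p pE] : exists p, p = 1 - s * d by exists (1 - s * d).
have pd : p * d = 0 by rewrite pE mulrBl mul1r sd -dsd subrr.
have bp : bicommutant x p.
  by rewrite pE; apply: bicommutantB; [exact: bicommutant1|exact: bicommutantM].
have pp : p * p = p by rewrite {2}pE mulrBr mulr1 sd mulrA pd mul0r subr0.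
have sp : s * p = s - s ^+ 2 * d by rewrite pE mulrBr mulr1 mulrA -expr2.
have [m [spm msp]] : invertible (1 - s * p).
  have := res (-1); rewrite mulN1r -sp; apply; apply/commr_sym/commrN; exact: commr1.
have bm : bicommutant x m.
  apply: (bicommutant_inverse _ (1 - s * p) _ spm msp).
  by apply: bicommutantB; [exact: bicommutant1|exact: bicommutantM].
have bt : bicommutant x (p * m) by exact: bicommutantM.
exists p, (p * m); split=> //; last by rewrite sp; split=> //; rewrite pE subKr.
  rewrite (bt x)//.
  have -> : x = 1 - s by rewrite -sE subKr.
  have e : (1 - s) * p = p * (1 - s * p).
    by rewrite mulrBl mul1r mulrBr mulr1 (bicommutant_comm _ _ _ bs bp) mulrA pp.
  by rewrite mulrA e -mulrA spm mulr1.
by rewrite mulrA pp.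
Qed.

(** Jacobson's lemma for balanced words.  Apart from membership in the double
commutant, the inverse b' below is correct because (1 - alpha) b' = 1 - q and
q b' = 0: the defect -(1 - q) alpha^4 of the truncated geometric series is
cancelled by the contribution of the tail h. *)
Lemma gDrazin_invertible_1sub_transfer {R : pzRingType} (a b c : R) :
  balanced_words a b c ->
  gDrazin_invertible (1 - b * a) -> gDrazin_invertible (1 - a * c).
Proof.
move=> bal [d dP]; have [_ /bicommutant_1sub bd _] := dP.
have [p [t [bt tba pt [sd pd sp]]]] := spectral_outer_inverse _ _ dP.
have tt : t * (b * a) * t = t by rewrite tba.
have bat : b * a * t = p by rewrite -(bt (b * a)).
have pC : GRing.comm p (b * a).
  by rewrite /GRing.comm -{1}bat -mulrA tba.
have tca := outer_ca bal bt tt.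
pose q := a * t * c.
have bq : bicommutant (a * c) q.
  have := bicommutant_outer bal bt tt 1 (bicommutant1 _).
  by rewrite mul1r.
have qac n : q * (a * c) ^+ n = a * (t * (b * a) ^+ n) * c.
  by have := outer_mul_acX bal bt tt 1 n; rewrite mul1r.
have qq : q * q = q by apply: (outer_idem bal bt tt).
(* The series stops at alpha^3 because the tail has to contain the factor beta^3
   for [bicommutant_transfer] to apply to it. *)
pose g := \sum_(i < 4) (a * c) ^+ i.
have Sg : (1 - a * c) * g = 1 - (a * c) ^+ 4.
  by rewrite -opprB mulNr -subrX1 opprB.
have bg : bicommutant (a * c) g.
  move=> y ya; apply/commr_sym/commr_sum => i _; exact: commrX.
pose h := a * ((b * a) ^+ 3 * d) * c.
have bh : bicommutant (a * c) h.
  have -> : h = a * d * (b * a) ^+ 3 * c.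
    by rewrite /h -(mulrA a d) (commrX 3 (bd (b * a) _)).
  exact: bicommutant_transfer.
have bS : bicommutant (a * c) (1 - a * c).
  by apply: bicommutantB; [exact: bicommutant1|exact: bicommutant_id].
have ac4 : (a * c) ^+ 4 = a * (b * a) ^+ 3 * c.
  by rewrite exprSr mulrA (ac3_a _ _ _ _ bal).
have Sh : (1 - a * c) * h = (a * c) ^+ 4 - q * (a * c) ^+ 4.
  have -> : (1 - a * c) * h = a * ((b * a) ^+ 3 * ((1 - b * a) * d)) * c.
    have -> : (1 - a * c) * h = (1 - a * c) * (a * (b * a) ^+ 3) * (d * c).
      by rewrite /h -!mulrA.
    have -> : (1 - a * c) * (a * (b * a) ^+ 3) = a * ((b * a) ^+ 3 * (1 - b * a)).
      by rewrite mulrBl mul1r aca_ba_pow// mulrBr mulr1 -exprSr mulrBr.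
    by rewrite -!mulrA.
  rewrite qac ac4 (exprS (b * a) 3) (mulrA t) tba sd.
  by rewrite (commrX 3 pC) mulrBr mulr1 mulrBr mulrBl.
pose b' := (1 - q) * g + h.
have Sb' : (1 - a * c) * b' = 1 - q.
  have qS : GRing.comm (1 - q) (1 - a * c).
    apply: (bicommutant_comm (a * c)) => //.
    by apply: bicommutantB => //; exact: bicommutant1.
  rewrite mulrDr mulrA -qS -mulrA Sg Sh mulrBl mul1r mulrBr mulr1.
  by rewrite opprB -addrA (addrC (_ - q)) !subrKA.
have bb' : bicommutant (a * c) b'.
  apply: bicommutantD => //; apply: bicommutantM => //.
  by apply: bicommutantB => //; exact: bicommutant1.
have qh : q * h = 0.
  have -> : q * h = a * (t * (c * a)) * (b * a) ^+ 3 * d * c.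
    by rewrite /q /h; move: (_ ^+ 3) => z; rewrite !mulrA.
  by rewrite tca tba -(mulrA a) (commrX 3 pC) -!mulrA (mulrA p) pd mul0r !mulr0.
have qb' : q * b' = 0.
  by rewrite mulrDr qh addr0 mulrA mulrBr mulr1 qq subrr mul0r.
exists b'; split.
- by rewrite -[RHS]mulrA Sb' (bicommutant_comm _ _ _ bb') ?mulrBl ?qb' ?mul1r ?subr0//;
    apply: bicommutantB => //; exact: bicommutant1.
- exact/bicommutant_1sub.
have -> : (1 - a * c) - (1 - a * c) ^+ 2 * b' = a * ((1 - b * a) * t * c).
  rewrite expr2 -(mulrA (1 - a * c)) Sb' mulrBr mulr1 subKr.
  rewrite mulrBl mul1r /q mulrBl mul1r mulrBl mulrBr.
  by rewrite !mulrA (aca_outer bal bt tt) !mulrA.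
apply: quasinilpotent_swap.
have -> : (1 - b * a) * t * c * a = (1 - b * a) * p.
  by rewrite -(mulrA _ c) -(mulrA _ t) tca tba.
exact: sp.
Qed.

(** * Both directions, and all points of the spectrum *)

(** The words x y y are balanced for all x and y, so P is invariant under
swapping the two factors of a product.  As balancedness is symmetric in b and c,
the converse follows along a c, c a, a b, b a. *)
Lemma balanced_words_transfer_iff {R : pzRingType} (P : R -> Prop) :
  (forall a b c, balanced_words a b c -> P (b * a) -> P (a * c)) ->
  forall a b c, balanced_words a b c -> (P (b * a) <-> P (a * c)).
Proof.
move=> transfer a b c bal; split; first exact: transfer.
have swap x y : P (y * x) -> P (x * y) by apply: transfer.
have bal' : balanced_words a c b.
  by case: bal => e1 e2 e3; split; rewrite ?(e1, e2, e3).
by move=> /swap/(transfer _ _ _ bal')/swap.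
Qed.

Lemma balanced_words_scale {K : numFieldType} {X : normedModType K} (k : K)
    (A B C : bounded_end X) :
  balanced_words A B C -> balanced_words (k *: A) B C.
Proof.
move=> [e1 e2 e3]; split;
  by rewrite -!(bounded_end_scaleAl, bounded_end_scaleAr) ?(e1, e2, e3).
Qed.

Lemma gDrazin_invertibleZ {K : numFieldType} {X : normedModType K} (k : K)
    (T : bounded_end X) :
  k != 0 -> (gDrazin_invertible (k *: T) <-> gDrazin_invertible T).
Proof.
have scale (l : K) (S : bounded_end X) :
    l != 0 -> gDrazin_invertible S -> gDrazin_invertible (l *: S).
  move=> l0.
  have scalarC (m : K) (U : bounded_end X) :
      GRing.comm (m *: (1 : bounded_end X)) U.
    by rewrite /GRing.comm -bounded_end_scaleAl -bounded_end_scaleAr mul1r mulr1.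
  have -> : l *: S = (l *: (1 : bounded_end X)) * S.
    by rewrite -bounded_end_scaleAl mul1r.
  apply: (gDrazin_invertibleM_central _ (l^-1 *: (1 : bounded_end X))) => //.
  by rewrite -bounded_end_scaleAl mul1r scalerA divff// scale1r.
move=> k0; split=> [/(scale k^-1)|]; last exact: scale.
by rewrite scalerA mulVf// scale1r; apply; rewrite invr_eq0.
Qed.

Lemma gDrazin_invertible_balanced {K : numFieldType} {X : normedModType K}
    (A B C : bounded_end X) (l : K) :
  balanced_words A B C ->
  (gDrazin_invertible (l *: (1 : bounded_end X) - B * A) <->
   gDrazin_invertible (l *: (1 : bounded_end X) - A * C)).
Proof.
move=> bal; have [->|l0] := eqVneq l 0.
  rewrite scale0r !sub0r -!scaleN1r bounded_end_scaleAr bounded_end_scaleAl.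
  (* At the origin the scalar only serves to absorb the sign of - T. *)
  apply: (balanced_words_transfer_iff _ (@gDrazin_invertible_transfer _)).
  exact: balanced_words_scale.
have factor (T : bounded_end X) :
    l *: (1 : bounded_end X) - T = l *: (1 - l^-1 *: T).
  by rewrite scalerBr scalerA divff// scale1r.
rewrite !factor !gDrazin_invertibleZ// bounded_end_scaleAr bounded_end_scaleAl.
apply: (balanced_words_transfer_iff (fun T => gDrazin_invertible (1 - T))
  (@gDrazin_invertible_1sub_transfer _)).
exact: balanced_words_scale.
Qed.

Theorem theorem3p2 (R : realType) (X : completeNormedModType R[i])
  (A B C : bounded_end X)
  (h1 : A * (B * A) ^+ 2 = A * B * A * C * A)
  (h2 : A * B * A * C * A = A * C * A * B * A)
  (h3 : A * C * A * B * A = (A * C) ^+ 2 * A) :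
  gDrazin_spectrum (A * C) = gDrazin_spectrum (B * A).
Proof.
have bal : balanced_words A B C.
  have e : A * B * A * B * A = A * B * A * C * A by rewrite -h1 expr2 !mulrA.
  by split; rewrite e// -?h2// h2 h3 expr2 !mulrA.
by apply/seteqP; split=> l; apply: contra_not => ?;
  apply/(gDrazin_invertible_balanced A B C l bal).
Qed.
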